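(* Let $\Bbbk$ be an algebraically closed field, let $\Lambda$ be a finite dimensional basic $\Bbbk$-algebra, and let $\widehat{\Lambda}$ be the repetitive algebra of $\Lambda$. Let $\widehat{h}:\widehat{M}\to\widehat{M}'$ be a morphism in $\widehat{\Lambda}\text{-mod}$ whose stable class $\underline{\widehat{h}}:\widehat{M}\to\widehat{M}'$ is an irreducible morphism in $\widehat{\Lambda}\text{-}\underline{\mathrm{mod}}$. Assume further that either $\widehat{M}$ or $\widehat{M}'$ is an indecomposable $\widehat{\Lambda}$-module and that neither $\widehat{M}$ nor $\widehat{M}'$ has projective direct summands as an object of $\widehat{\Lambda}\text{-mod}$. Then $\underline{\widehat{h}}$ is either stably smonic or stably sepic or stably sirreducible.
   Context: All modules are finitely generated left modules. Let $Q=D\Lambda=\mathrm{Hom}_\Bbbk(\Lambda,\Bbbk)$ with its canonical $\Lambda$-$\Lambda$-bimodule structure. The repetitive algebra $\widehat{\Lambda}$ has underlying space $\left(\bigoplus_{i\in\mathbb{Z}}\Lambda\right)\oplus\left(\bigoplus_{i\in\mathbb{Z}}Q\right)$, with elements $(a_i,\varphi_i)_i$ (almost all $a_i\in\Lambda$, $\varphi_i\in Q$ zero) and product $(a_i,\varphi_i)_i\cdot(b_i,\psi_i)_i=(a_ib_i,a_{i+1}\psi_i+\varphi_ib_i)_i$. The category $\widehat{\Lambda}\text{-mod}$ is described as follows: objects are $\widehat{M}=(M_i,f_i)_{i\in\mathbb{Z}}$ with $M_i$ finitely generated $\Lambda$-modules, almost all zero, and $\Lambda$-morphisms $f_i:Q\otimes_\Lambda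 M_i\to M_{i+1}$ with $f_{i+1}\circ(\mathrm{id}_Q\otimes f_i)=0$; a morphism $\widehat{h}:\widehat{M}\to\widehat{M}'$ is a sequence $\widehat{h}=(h_i)_{i\in\mathbb{Z}}$ of $\Lambda$-morphisms $h_i:M_i\to M_i'$ (the component morphisms) with $h_{i+1}\circ f_i=f_i'\circ(\mathrm{id}_Q\otimes h_i)$ for all $i$. $\widehat{\Lambda}\text{-mod}$ is a Frobenius category (projectives and injectives coincide). Its stable category $\widehat{\Lambda}\text{-}\underline{\mathrm{mod}}$ has the same objects, and morphisms are morphisms of $\widehat{\Lambda}\text{-mod}$ modulo those factoring through a finitely generated projective-injective $\widehat{\Lambda}$-module; $\underline{\widehat{h}}$ denotes the class of $\widehat{h}$. In an additive category, $f:X\to Y$ is a split mono (resp. split epi) if there is $g:Y\to X$ with $g\circ f=\mathrm{id}_X$ (resp. $f\circ g=\mathrm{id}_Y$). The morphism $f$ is irreducible if it is neither a split mono nor a split epi, and whenever $f=v\circ u$, either $u$ is a split mono or $v$ is a split epi. A morphism $\widehat{h}=(h_i)_i$ in $\widehat{\Lambda}\text{-mod}$ is smonic (resp. sepic) if every $h_i$ is a split mono (resp. split epi) in $\Lambda\text{-mod}$. An irreducible morphism $\widehat{h}$ in $\widehat{\Lambda}\text{-mod}$ is sirreducible if there is $i_0\in\mathbb{Z}$ such that $h_{i_0}$ is neither a split mono nor a split epi, this $i_0$ is unique, and $h_{i_0}$ is irreducible in $\Lambda\text{-mod}$. For an irreducible morphism $\underline{\widehat{h}}:\widehat{M}\to\widehat{M}'$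 in $\widehat{\Lambda}\text{-}\underline{\mathrm{mod}}$ with $\widehat{M}$ or $\widehat{M}'$ indecomposable and neither having projective direct summands, $\underline{\widehat{h}}$ is called stably smonic (resp. stably sepic, stably sirreducible) if $\widehat{h}$ is smonic (resp. sepic, sirreducible) in $\widehat{\Lambda}\text{-mod}$. *)

(* Defs.v *)
From HB Require Import structures.
From mathcomp Require Import all_boot all_order all_algebra all_field.
From mathcomp Require Import boolp.
From mathcomp Require Import freeg.

Set Implicit Arguments.
Unset Strict Implicit.
Unset Printing Implicit Defensive.

Import GRing.Theory.
Local Open Scope ring_scope.
Local Open Scope quotient_scope.

(* Hom-sets carry an explicit equality [heq], so that a quotient category has  *)
(* the same homs as the original one and only a coarser [heq].                 *)
Record category := Category {
  obj :> Type;
  hom : obj -> obj -> Type;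
  heq : forall X Y, hom X Y -> hom X Y -> Prop;
  idm : forall X, hom X X;
  cmp : forall X Y Z, hom Y Z -> hom X Y -> hom X Z;
  heq_refl : forall X Y (f : hom X Y), heq f f;
  heq_sym : forall X Y (f g : hom X Y), heq f g -> heq g f;
  heq_trans : forall X Y (f g h : hom X Y), heq f g -> heq g h -> heq f h;
  cmp_heq : forall X Y Z (f f' : hom X Y) (g g' : hom Y Z),
    heq f f' -> heq g g' -> heq (cmp g f) (cmp g' f');
  cmp1m : forall X Y (f : hom X Y), heq (cmp (idm Y) f) f;
  cmpm1 : forall X Y (f : hom X Y), heq (cmp f (idm X)) f;
  cmpA : forall X Y Z W (f : hom X Y) (g : hom Y Z) (h : hom Z W),
    heq (cmp h (cmp g f)) (cmp (cmp h g) f)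
}.
Arguments hom {c} X Y.
Arguments heq {c X Y} f g.
Arguments idm {c} X.
Arguments cmp {c X Y Z} g f.

Section CategoryNotions.
Variable C : category.

Definition split_mono (X Y : C) (f : hom X Y) :=
  exists g : hom Y X, heq (cmp g f) (idm X).

Definition split_epi (X Y : C) (f : hom X Y) :=
  exists g : hom Y X, heq (cmp f g) (idm Y).

Definition irreducible (X Y : C) (f : hom X Y) :=
  [/\ ~ split_mono f, ~ split_epi f &
      forall (Z : C) (u : hom X Z) (v : hom Z Y),
        heq f (cmp v u) -> split_mono u \/ split_epi v].

Definition isomorphic (X Y : C) :=
  exists (f : hom X Y) (g : hom Y X),
    heq (cmp g f) (idm X) /\ heq (cmp f g) (idm Y).

End CategoryNotions.

Section Modules.
Variable R : nzRingType.

Definition finitely_generated (M : lmodType R) :=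
  exists (n : nat) (g : 'I_n -> M),
    forall x : M, exists c : 'I_n -> R, x = \sum_(i < n) c i *: g i.

Record fgmod := FgMod {
  fgmod_sort :> lmodType R;
  fgmodP : finitely_generated fgmod_sort
}.

Lemma finitely_generated_prod (M N : lmodType R) :
  finitely_generated M -> finitely_generated N ->
  finitely_generated (M * N)%type.
Proof.
move=> [m [g gP]] [n [h hP]].
exists (m + n)%N, (fun i => match split i with
                            | inl j => (g j, 0) | inr j => (0, h j) end).
move=> [x y]; have [c ->] := gP x; have [d ->] := hP y.
exists (fun i => match split i with inl j => c j | inr j => d j end).
rewrite big_split_ord /=.
have splitL i : split (lshift n i) = inl i by exact: (unsplitK (inl i)).
have splitR i : split (rshift m i) = inr i by exact: (unsplitK (inr i)).
under [X in _ = X + _]eq_bigr => i _ do rewrite splitL.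
under [X in _ = _ + X]eq_bigr => i _ do rewrite splitR.
rewrite [LHS]surjective_pairing [RHS]surjective_pairing /=.
rewrite !(raddf_sum fst) !(raddf_sum snd) /=.
congr pair.
  by rewrite [X in _ + X]big1 ?addr0 // => i _; rewrite scaler0.
by rewrite [X in X + _]big1 ?add0r // => i _; rewrite scaler0.
Qed.

Definition fgmod_prod (M N : fgmod) : fgmod :=
  FgMod (finitely_generated_prod (fgmodP M) (fgmodP N)).

Section ModCategory.
Local Notation lhom X Y := {linear (X : fgmod) -> (Y : fgmod)}.
Local Notation lcmp X Z g f := (g \o f : lhom X Z).

Lemma lin_refl X Y (f : lhom X Y) : f =1 f.
Proof. by []. Qed.

Lemma lin_sym X Y (f g : lhom X Y) : f =1 g -> g =1 f.
Proof. by move=> fg x; rewrite fg. Qed.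

Lemma lin_trans X Y (f g h : lhom X Y) : f =1 g -> g =1 h -> f =1 h.
Proof. by move=> fg gh x; rewrite fg. Qed.

Lemma lin_cmp X Y Z (f f' : lhom X Y) (g g' : lhom Y Z) :
  f =1 f' -> g =1 g' -> lcmp X Z g f =1 lcmp X Z g' f'.
Proof. by move=> ff' gg' x /=; rewrite ff' gg'. Qed.

Lemma lin_1m X Y (f : lhom X Y) : lcmp X Y idfun f =1 f.
Proof. by []. Qed.

Lemma lin_m1 X Y (f : lhom X Y) : lcmp X Y f idfun =1 f.
Proof. by []. Qed.

Lemma lin_A X Y Z W (f : lhom X Y) (g : lhom Y Z) (h : lhom Z W) :
  lcmp X W h (lcmp X Z g f) =1 lcmp X W (lcmp Y W h g) f.
Proof. by []. Qed.

Definition mod_category : category :=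
  @Category fgmod (fun X Y => lhom X Y) (fun X Y f g => f =1 g)
    (fun X => idfun : lhom X X) (fun X Y Z g f => lcmp X Z g f)
    lin_refl lin_sym lin_trans lin_cmp lin_1m lin_m1 lin_A.

End ModCategory.
End Modules.

Section BasicAlgebra.
Variables (k : fieldType) (L : falgType k).

(* The left ideal L e, as a left module. *)
Definition in_lideal (e : L) : pred L^o := fun x => (x : L) \in limg (amulr e).

Lemma in_lideal_closed e : submod_closed (in_lideal e).
Proof.
split; first exact: (mem0v (limg (amulr e))).
move=> a x y /memv_imgP[u _ xE] /memv_imgP[v _ yE].
rewrite unfold_in /in_lideal xE yE; apply/memv_imgP.
exists (a * u + v); first exact: memvf.
by rewrite !lfunE /= mulrDl -mulrA.
Qed.

HB.instance Definition _ e :=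
  GRing.isSubmodClosed.Build L L^o (in_lideal e) (in_lideal_closed e).

Definition lideal (e : L) := {x : L^o | in_lideal e x}.
HB.instance Definition _ e := SubChoice.on (lideal e).
HB.instance Definition _ e := [SubChoice_isSubLmodule of lideal e by <:].

Definition idempotent (e : L) := e * e = e.

Definition primitive (e : L) :=
  [/\ idempotent e, e != 0 &
      ~ exists e1 e2 : L,
          [/\ idempotent e1 /\ e1 != 0, idempotent e2 /\ e2 != 0,
              e1 * e2 = 0 /\ e2 * e1 = 0 & e = e1 + e2]].

Definition complete_primitive n (e : 'I_n -> L) :=
  [/\ forall i, primitive (e i),
      forall i j, i != j -> e i * e j = 0 &
      \sum_(i < n) e i = 1].

Definition basic :=
  exists (n : nat) (e : 'I_n -> L), complete_primitive e /\
    forall i j,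
      (exists f : {linear lideal (e i) -> lideal (e j)}, bijective f) -> i = j.

End BasicAlgebra.

Section Dual.
Variables (k : fieldType) (L : falgType k).

Definition dual := 'Hom(L, k^o).
HB.instance Definition _ := Choice.on dual.
HB.instance Definition _ := GRing.Zmodule.on dual.

(* (a phi)(x) = phi (x a) and (phi a)(x) = phi (a x). *)
Definition lact (a : L) (phi : dual) : dual := (phi \o amulr a)%VF.
Definition ract (phi : dual) (a : L) : dual := (phi \o amull a)%VF.

Lemma lactE a phi x : lact a phi x = phi (x * a).
Proof. by rewrite /lact comp_lfunE lfunE. Qed.

Lemma ractE a phi x : ract phi a x = phi (a * x).
Proof. by rewrite /ract comp_lfunE lfunE. Qed.

Lemma lactA a b phi : lact a (lact b phi) = lact (a * b) phi.
Proof. by apply/lfunP => x; rewrite !lactE mulrA. Qed.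

Lemma lact1 : left_id 1 lact.
Proof. by move=> phi; apply/lfunP => x; rewrite lactE mulr1. Qed.

Lemma lactDr : right_distributive lact +%R.
Proof. by move=> a p q; apply/lfunP => x; rewrite lactE !add_lfunE !lactE. Qed.

Lemma lactDl p : {morph lact^~ p : a b / a + b}.
Proof.
by move=> a b; apply/lfunP => x; rewrite add_lfunE !lactE mulrDr raddfD.
Qed.

HB.instance Definition _ := GRing.Zmodule_isLmodule.Build L dual
  lactA lact1 lactDr lactDl.

End Dual.

(* The tensor product Q (x)_L M over the (noncommutative) algebra L, as the    *)
(* quotient of the free abelian group on Q * M by the usual relations.         *)
Section Tensor.
Variables (k : fieldType) (L : falgType k).
Local Notation Q := (dual L).
Implicit Types (M : lmodType L).

Definition fgen M (q : Q) (m : M) : {freeg (Q * M)} := << (q, m) >>.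

Inductive tens_rel M : {freeg (Q * M)} -> Prop :=
| tens_relDl q q' m : tens_rel (fgen (q + q') m - (fgen q m + fgen q' m))
| tens_relDr q m m' : tens_rel (fgen q (m + m') - (fgen q m + fgen q m'))
| tens_relM q a m : tens_rel (fgen (ract q a) m - fgen q (a *: m)).

Inductive tens_span M : {freeg (Q * M)} -> Prop :=
| tens_span_rel x : tens_rel x -> tens_span x
| tens_span0 : tens_span 0
| tens_spanB x y : tens_span x -> tens_span y -> tens_span (x - y).

Definition tens_null M : pred {freeg (Q * M)} := fun x => `[< tens_span x >].

Lemma tens_null_closed M : zmod_closed (@tens_null M).
Proof.
split; first by apply/asboolP; exact: tens_span0.
by move=> x y /asboolP xN /asboolP yN; apply/asboolP; exact: tens_spanB.
Qed.

HB.instance Definition _ M :=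
  GRing.isZmodClosed.Build {freeg (Q * M)} (@tens_null M) (tens_null_closed M).

Definition tens_ideal M := GRing.ZmodClosed.clone _ (@tens_null M) _.
Definition tens M : Type := Quotient.quot (tens_ideal M).
HB.instance Definition _ M := GRing.Zmodule.on (tens M).

Definition tproj M (x : {freeg (Q * M)}) : tens M :=
  \pi_(Quotient.quot (tens_ideal M)) x.
Definition tpure M (q : Q) (m : M) : tens M := tproj (fgen q m).

Lemma tprojB M : zmod_morphism (@tproj M).
Proof. exact: (@raddfB _ _ \pi_(Quotient.quot (tens_ideal M))). Qed.

HB.instance Definition _ M :=
  GRing.isZmodMorphism.Build _ _ (@tproj M) (@tprojB M).

Lemma tproj_eq0 M (x : {freeg (Q * M)}) : tens_span x -> tproj x = 0.
Proof.
move=> xN; rewrite /tproj -[0]/(0 : Quotient.quot (tens_ideal M)).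
rewrite -(raddf0 \pi).
by apply/eqP; rewrite -Quotient.idealrBE subr0; apply/asboolP.
Qed.

Lemma tproj_surj M (t : tens M) : exists x, t = tproj x.
Proof. by exists (repr t); rewrite /tproj reprK. Qed.

Lemma tpureDl M q q' (m : M) : tpure (q + q') m = tpure q m + tpure q' m.
Proof.
apply/eqP; rewrite -subr_eq0 -raddfD -raddfB; apply/eqP/tproj_eq0.
by constructor; constructor.
Qed.

Lemma tpureDr M q (m m' : M) : tpure q (m + m') = tpure q m + tpure q m'.
Proof.
apply/eqP; rewrite -subr_eq0 -raddfD -raddfB; apply/eqP/tproj_eq0.
by constructor; constructor.
Qed.

Lemma tpureM M q a (m : M) : tpure (ract q a) m = tpure q (a *: m).
Proof.
apply/eqP; rewrite -subr_eq0 -raddfB; apply/eqP/tproj_eq0.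
by constructor; constructor.
Qed.

Lemma tpure0r M q : tpure q (0 : M) = 0.
Proof. by apply: (addrI (tpure q 0)); rewrite addr0 -tpureDr addr0. Qed.

Lemma tpureNr M q (m : M) : tpure q (- m) = - tpure q m.
Proof. by apply: (addrI (tpure q m)); rewrite -tpureDr !subrr tpure0r. Qed.

Lemma tens_eq M (N : zmodType) (f g : {additive tens M -> N}) :
  (forall q m, f (tpure q m) = g (tpure q m)) -> f =1 g.
Proof.
move=> fg t; have [x ->] := tproj_surj t.
rewrite -[x]freeg_sumE !raddf_sum; apply: eq_bigr => [[q m]] _.
rewrite -[coeff _ _]intz -freegU_mulz !raddfMz.
by congr (_ *~ _); apply: fg.
Qed.

(* Universal property. *)
Section Lift.
Variables (M : lmodType L) (N : zmodType) (b : Q -> M -> N).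
Hypothesis bDl : forall q q' m, b (q + q') m = b q m + b q' m.
Hypothesis bDr : forall q m m', b q (m + m') = b q m + b q m'.
Hypothesis bM : forall q a m, b (ract q a) m = b q (a *: m).

Definition free_lift (x : {freeg (Q * M)}) : N :=
  fglift (fun p => b p.1 p.2 : zmodule N) x.

Lemma free_liftB : zmod_morphism free_lift.
Proof. exact: (@lift_is_additive _ _ (zmodule N)). Qed.

HB.instance Definition _ := GRing.isZmodMorphism.Build _ _ free_lift free_liftB.

Lemma free_liftE q m : free_lift (fgen q m) = b q m.
Proof. by rewrite /free_lift liftU scale1r. Qed.

Lemma free_lift_eq0 x : tens_span x -> free_lift x = 0.
Proof.
elim=> [_ [q q' m|q m m'|q a m]||y z _ y0 _ z0].
- by rewrite raddfB raddfD /= !free_liftE bDl subrr.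
- by rewrite raddfB raddfD /= !free_liftE bDr subrr.
- by rewrite raddfB /= !free_liftE bM subrr.
- exact: raddf0.
- by rewrite raddfB /= y0 z0 subr0.
Qed.

Definition tlift (t : tens M) : N := free_lift (repr t).

Lemma tlift_proj x : tlift (tproj x) = free_lift x.
Proof.
apply/eqP; rewrite -subr_eq0 -raddfB; apply/eqP/free_lift_eq0/asboolP.
suff: repr (tproj x) - x \in tens_ideal M by [].
by rewrite Quotient.idealrBE /tproj reprK.
Qed.

Lemma tliftE q m : tlift (tpure q m) = b q m.
Proof. by rewrite tlift_proj free_liftE. Qed.

Lemma tliftB : zmod_morphism tlift.
Proof.
move=> s t; have [x ->] := tproj_surj s; have [y ->] := tproj_surj t.
by rewrite -raddfB !tlift_proj raddfB.
Qed.

End Lift.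

(* The left L-module structure a (q (x) m) = (a q) (x) m. *)
Lemma ractDl (q q' : Q) a : ract (q + q') a = ract q a + ract q' a.
Proof. by apply/lfunP => x; rewrite ractE !add_lfunE !ractE. Qed.

Lemma ract_lact a b (q : Q) : ract (a *: q) b = a *: ract q b.
Proof. by apply/lfunP => x; rewrite ractE !lactE ractE mulrA. Qed.

Section Scale.
Variable M : lmodType L.
Implicit Types (a : L) (t : tens M).

Let scale_fun a (q : Q) (m : M) := tpure (a *: q) m.

Let scaleDl a q q' m :
  scale_fun a (q + q') m = scale_fun a q m + scale_fun a q' m.
Proof. by rewrite /scale_fun scalerDr tpureDl. Qed.

Let scaleDr a q m m' :
  scale_fun a q (m + m') = scale_fun a q m + scale_fun a q m'.
Proof. exact: tpureDr. Qed.

Let scaleM a q c m : scale_fun a (ract q c) m = scale_fun a q (c *: m).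
Proof. by rewrite /scale_fun -ract_lact tpureM. Qed.

Definition tscale a t : tens M := tlift (scale_fun a) t.

Lemma tscaleE a q m : tscale a (tpure q m) = tpure (a *: q) m.
Proof. exact: tliftE. Qed.

Lemma tscaleB a : zmod_morphism (tscale a).
Proof. exact: tliftB. Qed.

HB.instance Definition _ a :=
  GRing.isZmodMorphism.Build _ _ (tscale a) (@tscaleB a).

Lemma tscaleA a b t : tscale a (tscale b t) = tscale (a * b) t.
Proof.
move: t; apply: (@tens_eq _ _ (tscale a \o tscale b) (tscale (a * b))) => q m.
by rewrite /= !tscaleE scalerA.
Qed.

Lemma tscale1 : left_id 1 tscale.
Proof.
by apply: (@tens_eq _ _ (tscale 1) idfun) => q m; rewrite /= tscaleE scale1r.
Qed.

Lemma tscaleDr : right_distributive tscale +%R.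
Proof. by move=> a s t; rewrite raddfD. Qed.

Lemma tscaleDl t : {morph tscale^~ t : a b / a + b}.
Proof.
move=> a b; move: t.
apply: (@tens_eq _ _ (tscale (a + b)) (tscale a \+ tscale b)) => q m.
by rewrite /= !tscaleE scalerDl tpureDl.
Qed.

HB.instance Definition _ := GRing.Zmodule_isLmodule.Build L (tens M)
  tscaleA tscale1 tscaleDr tscaleDl.

Lemma tpureZ a q m : a *: tpure q m = tpure (a *: q) m.
Proof. exact: tscaleE. Qed.

End Scale.

(* The map id_Q (x) h. *)
Section Map.
Variables (M N : lmodType L) (h : {linear M -> N}).

Let map_fun (q : Q) (m : M) := tpure q (h m).

Let mapDl q q' m : map_fun (q + q') m = map_fun q m + map_fun q' m.
Proof. exact: tpureDl. Qed.

Let mapDr q m m' : map_fun q (m + m') = map_fun q m + map_fun q m'.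
Proof. by rewrite /map_fun raddfD tpureDr. Qed.

Let mapM q c m : map_fun (ract q c) m = map_fun q (c *: m).
Proof. by rewrite /map_fun tpureM linearZ. Qed.

Definition tmap (t : tens M) : tens N := tlift map_fun t.

Lemma tmapE q m : tmap (tpure q m) = tpure q (h m).
Proof. exact: tliftE. Qed.

Lemma tmapB : zmod_morphism tmap.
Proof. exact: tliftB. Qed.

HB.instance Definition _ := GRing.isZmodMorphism.Build _ _ tmap tmapB.

Lemma tmapZ : scalable tmap.
Proof.
move=> a t; move: t.
apply: (@tens_eq _ _ (tmap \o *:%R a) ( *:%R a \o tmap)) => q m.
by rewrite /= !tpureZ !tmapE tpureZ.
Qed.

HB.instance Definition _ := GRing.isScalable.Build _ _ _ _ tmap tmapZ.

End Map.
End Tensor.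
Arguments tpure {k L M}.

Lemma tmap_ext (k : fieldType) (L : falgType k) (M N : lmodType L)
    (f g : {linear M -> N}) : f =1 g -> tmap f =1 tmap g.
Proof. by move=> fg; apply: tens_eq => q m; rewrite /= !tmapE fg. Qed.

Lemma tmap_id (k : fieldType) (L : falgType k) (M : lmodType L) :
  tmap (idfun : {linear M -> M}) =1 id.
Proof. by apply: (@tens_eq _ _ _ _ _ idfun) => q m; rewrite /= tmapE. Qed.

Lemma tmap_comp (k : fieldType) (L : falgType k) (M N P : lmodType L)
    (g : {linear N -> P}) (f : {linear M -> N}) :
  tmap (g \o f) =1 tmap g \o tmap f.
Proof.
by apply: (@tens_eq _ _ _ _ _ (tmap g \o tmap f)) => q m; rewrite /= !tmapE.
Qed.

(* Finitely generated modules over the repetitive algebra. *)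
Section Repetitive.
Variables (k : fieldType) (L : falgType k).

Record repmod := RepMod {
  rcomp :> int -> fgmod L;
  rmap : forall i, {linear tens (rcomp i) -> rcomp (i + 1)};
  rmap_comp : forall i (t : tens (tens (rcomp i))),
    rmap (i + 1) (tmap (rmap i) t) = 0;
  rcomp_fin : exists s : seq int,
    forall i, i \notin s -> forall x : rcomp i, x = 0
}.
Arguments rmap : clear implicits.

Record repmor (M N : repmod) := RepMor {
  mcomp :> forall i, {linear M i -> N i};
  mcompP : forall i (t : tens (M i)),
    mcomp (i + 1) (rmap M i t) = rmap N i (tmap (mcomp i) t)
}.

Definition repmor_eq (M N : repmod) (f g : repmor M N) :=
  forall i, f i =1 g i.

Lemma repmor_id_proof (M : repmod) i (t : tens (M i)) :
  (idfun : {linear M (i + 1) -> M (i + 1)}) (rmap M i t) =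
  rmap M i (tmap (idfun : {linear M i -> M i}) t).
Proof. by rewrite tmap_id. Qed.

Definition repmor_id (M : repmod) : repmor M M :=
  RepMor (@repmor_id_proof M).

Lemma repmor_comp_proof (M N P : repmod) (g : repmor N P) (f : repmor M N)
    i (t : tens (M i)) :
  (g (i + 1) \o f (i + 1) : {linear M (i + 1) -> P (i + 1)}) (rmap M i t) =
  rmap P i (tmap (g i \o f i : {linear M i -> P i}) t).
Proof. by rewrite /= !mcompP tmap_comp. Qed.

Definition repmor_comp (M N P : repmod) (g : repmor N P) (f : repmor M N) :
    repmor M P := RepMor (repmor_comp_proof g f).

Section RepLaws.
Implicit Types M N P T : repmod.

Lemma rep_refl M N (f : repmor M N) : repmor_eq f f.
Proof. by []. Qed.

Lemma rep_sym M N (f g : repmor M N) : repmor_eq f g -> repmor_eq g f.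
Proof. by move=> fg i x; rewrite fg. Qed.

Lemma rep_trans M N (f g h : repmor M N) :
  repmor_eq f g -> repmor_eq g h -> repmor_eq f h.
Proof. by move=> fg gh i x; rewrite fg gh. Qed.

Lemma rep_cmp M N P (f f' : repmor M N) (g g' : repmor N P) :
  repmor_eq f f' -> repmor_eq g g' ->
  repmor_eq (repmor_comp g f) (repmor_comp g' f').
Proof. by move=> ff' gg' i x /=; rewrite ff' gg'. Qed.

Lemma rep_1m M N (f : repmor M N) : repmor_eq (repmor_comp (repmor_id N) f) f.
Proof. by []. Qed.

Lemma rep_m1 M N (f : repmor M N) : repmor_eq (repmor_comp f (repmor_id M)) f.
Proof. by []. Qed.

Lemma rep_A M N P T (f : repmor M N) (g : repmor N P) (h : repmor P T) :
  repmor_eq (repmor_comp h (repmor_comp g f)) (repmor_comp (repmor_comp h g) f).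
Proof. by []. Qed.

End RepLaws.

Definition rep_category : category :=
  @Category repmod repmor repmor_eq repmor_id repmor_comp
    rep_refl rep_sym rep_trans rep_cmp rep_1m rep_m1 rep_A.

Definition rep_zero (M : repmod) := forall i (x : M i), x = 0.

Section DirectSum.
Variables M N : repmod.

Definition dsum_map i (t : tens (M i * N i)%type) :
    fgmod_prod (M (i + 1)) (N (i + 1)) :=
  (rmap M i (tmap fst t), rmap N i (tmap snd t)).

Lemma dsum_map_linear i : linear (@dsum_map i).
Proof. by move=> a s t; rewrite /dsum_map !linearP. Qed.

HB.instance Definition _ i :=
  GRing.isLinear.Build _ _ _ _ (@dsum_map i) (@dsum_map_linear i).

Lemma dsum_map_comp i (t : tens (tens (fgmod_prod (M i) (N i)))) :
  @dsum_map (i + 1) (tmap (@dsum_map i) t) = 0.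
Proof.
have E1 : tmap fst (tmap (@dsum_map i) t) = tmap (rmap M i) (tmap (tmap fst) t).
  move: t; apply: (@tens_eq _ _ _ _ (tmap fst \o tmap (@dsum_map i))
    (tmap (rmap M i) \o tmap (tmap fst))) => q m.
  by rewrite /= !tmapE.
have E2 : tmap snd (tmap (@dsum_map i) t) = tmap (rmap N i) (tmap (tmap snd) t).
  move: t {E1}; apply: (@tens_eq _ _ _ _ (tmap snd \o tmap (@dsum_map i))
    (tmap (rmap N i) \o tmap (tmap snd))) => q m.
  by rewrite /= !tmapE.
by rewrite /dsum_map E1 E2 !rmap_comp.
Qed.

Lemma dsum_fin : exists s : seq int,
  forall i, i \notin s -> forall x : fgmod_prod (M i) (N i), x = 0.
Proof.
have [s sP] := rcomp_fin M; have [r rP] := rcomp_fin N.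
exists (s ++ r) => i; rewrite mem_cat negb_or => /andP[si ri] [x y].
by rewrite (sP i si x) (rP i ri y).
Qed.

Definition dsum : repmod := RepMod dsum_map_comp dsum_fin.

Lemma fst_proof i (t : tens (dsum i)) :
  (fst : {linear dsum (i + 1) -> M (i + 1)}) (rmap dsum i t) =
  rmap M i (tmap (fst : {linear dsum i -> M i}) t).
Proof. by []. Qed.

Lemma snd_proof i (t : tens (dsum i)) :
  (snd : {linear dsum (i + 1) -> N (i + 1)}) (rmap dsum i t) =
  rmap N i (tmap (snd : {linear dsum i -> N i}) t).
Proof. by []. Qed.

Definition dsum_fst : repmor dsum M := RepMor fst_proof.
Definition dsum_snd : repmor dsum N := RepMor snd_proof.

Section Pair.
Variables (X : repmod) (f : repmor X M) (g : repmor X N).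

Definition pair_map i (x : X i) : dsum i := (f i x, g i x).

Lemma pair_map_linear i : linear (@pair_map i).
Proof. by move=> a x y; rewrite /pair_map !linearP. Qed.

HB.instance Definition _ i :=
  GRing.isLinear.Build _ _ _ _ (@pair_map i) (@pair_map_linear i).

Lemma pair_proof i (t : tens (X i)) :
  pair_map (rmap X i t) = rmap dsum i (tmap (@pair_map i) t).
Proof.
rewrite /pair_map !mcompP /= /dsum_map; congr pair; congr (rmap _ _ _).
  move: t; apply: (@tens_eq _ _ _ _ _ (tmap fst \o tmap (@pair_map i))) => q m.
  by rewrite /= !tmapE.
move: t; apply: (@tens_eq _ _ _ _ _ (tmap snd \o tmap (@pair_map i))) => q m.
by rewrite /= !tmapE.
Qed.

Definition repmor_pair : repmor X dsum := RepMor pair_proof.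

End Pair.
End DirectSum.

Section Additive.
Variables M N : repmod.
Implicit Types f g : repmor M N.

Lemma add_proof f g i (t : tens (M i)) :
  (f (i + 1) \+ g (i + 1) : {linear M (i + 1) -> N (i + 1)}) (rmap M i t) =
  rmap N i (tmap (f i \+ g i : {linear M i -> N i}) t).
Proof.
rewrite /= !mcompP -raddfD; congr (rmap _ _ _); move: t.
apply: (@tens_eq _ _ _ _ (tmap (f i) \+ tmap (g i))) => q m.
by rewrite /= !tmapE tpureDr.
Qed.

Definition repmor_add f g : repmor M N := RepMor (add_proof f g).

Definition opp_map f i (x : M i) : N i := - f i x.

Lemma opp_map_linear f i : linear (@opp_map f i).
Proof. by move=> a x y; rewrite /opp_map linearP opprD scalerN. Qed.

HB.instance Definition _ f i :=
  GRing.isLinear.Build _ _ _ _ (@opp_map f i) (@opp_map_linear f i).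

Lemma opp_proof f i (t : tens (M i)) :
  opp_map f (rmap M i t) = rmap N i (tmap (@opp_map f i) t).
Proof.
rewrite /opp_map mcompP -raddfN; congr (rmap _ _ _); move: t.
apply: (@tens_eq _ _ _ _ (-%R \o tmap (f i))) => q m.
by rewrite /= !tmapE tpureNr.
Qed.

Definition repmor_opp f : repmor M N := RepMor (opp_proof f).

End Additive.

Lemma zero_fg : finitely_generated 'rV[L]_0.
Proof.
exists 0, (fun=> 0) => x; exists (fun=> 0).
by rewrite big_ord0; apply/rowP => -[].
Qed.

Lemma zero_map_comp (i : int) (t : tens (tens 'rV[L]_0)) :
  (\0 : {linear tens 'rV[L]_0 -> 'rV[L]_0})
    (tmap (\0 : {linear tens 'rV[L]_0 -> 'rV[L]_0}) t) = 0.
Proof. by []. Qed.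

Lemma zero_fin : exists s : seq int,
  forall i, i \notin s -> forall x : (fun _ : int => FgMod zero_fg) i, x = 0.
Proof. by exists [::] => i _ x; apply/rowP => -[]. Qed.

Definition repmod0 : repmod := 
  @RepMod (fun=> FgMod zero_fg) (fun=> \0) zero_map_comp zero_fin.

Lemma repmod0P : rep_zero repmod0.
Proof. by move=> i x; apply/rowP => -[]. Qed.

Lemma null_proof (M N : repmod) i (t : tens (M i)) :
  (\0 : {linear M (i + 1) -> N (i + 1)}) (rmap M i t) =
  rmap N i (tmap (\0 : {linear M i -> N i}) t).
Proof.
rewrite /= -[LHS](raddf0 (rmap N i)); congr (rmap _ _ _); move: t.
by apply: (@tens_eq _ _ _ _ \0) => q m; rewrite /= tmapE tpure0r.
Qed.

Definition repmor_null (M N : repmod) : repmor M N := RepMor (@null_proof M N).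

Definition rep_projective (P : repmod) :=
  forall (M N : repmod) (g : repmor M N) (f : repmor P N),
    (forall i (y : N i), exists x, g i x = y) ->
    exists l : repmor P M, repmor_eq (repmor_comp g l) f.

Definition rep_injective (I : repmod) :=
  forall (M N : repmod) (g : repmor M N) (f : repmor M I),
    (forall i, injective (g i)) ->
    exists l : repmor N I, repmor_eq (repmor_comp l g) f.

Definition proj_inj (P : repmod) := rep_projective P /\ rep_injective P.

Lemma proj_inj0 : proj_inj repmod0.
Proof.
split=> M N g f _; first exists (repmor_null _ _).
  by move=> i x; rewrite (repmod0P x) !raddf0.
by exists (repmor_null _ _) => i x; rewrite [RHS]repmod0P [LHS]repmod0P.
Qed.

Definition dsum_inl P Q : repmor P (dsum P Q) :=
  repmor_pair (repmor_id P) (repmor_null P Q).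

Definition dsum_inr P Q : repmor Q (dsum P Q) :=
  repmor_pair (repmor_null Q P) (repmor_id Q).

Lemma proj_inj_dsum P Q : proj_inj P -> proj_inj Q -> proj_inj (dsum P Q).
Proof.
move=> [Pp Pi] [Qp Qi]; split=> M N g f gP.
  have [l1 l1E] := Pp M N g (repmor_comp f (dsum_inl P Q)) gP.
  have [l2 l2E] := Qp M N g (repmor_comp f (dsum_inr P Q)) gP.
  exists (repmor_add (repmor_comp l1 (dsum_fst P Q))
                     (repmor_comp l2 (dsum_snd P Q))) => i [x y] /=.
  rewrite raddfD; have /= -> := l1E i x; have /= -> := l2E i y.
  rewrite -raddfD /=; congr (f i _).
  by rewrite /pair_map /= -[RHS]/(x, y); congr pair; rewrite ?addr0 ?add0r.
have [l1 l1E] := Pi M N g (repmor_comp (dsum_fst P Q) f) gP.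
have [l2 l2E] := Qi M N g (repmor_comp (dsum_snd P Q) f) gP.
exists (repmor_pair l1 l2) => i x /=; rewrite /pair_map.
have /= -> := l1E i x; have /= -> := l2E i x.
by case: (f i x).
Qed.

(* Two parallel morphisms agree stably when their difference factors through   *)
(* a projective-injective object.                                              *)
Definition stable_eq (M N : repmod) (f g : repmor M N) :=
  exists (P : repmod) (u : repmor M P) (v : repmor P N),
    proj_inj P /\ forall i x, f i x - g i x = v i (u i x).

Section StableLaws.
Implicit Types M N P T : repmod.

Lemma repmor_eq_stable M N (f g : repmor M N) : repmor_eq f g -> stable_eq f g.
Proof.
move=> fg; exists repmod0, (repmor_null _ _), (repmor_null _ _).
by split=> [|i x]; [exact: proj_inj0 | rewrite fg subrr].
Qed.

Lemma stable_refl M N (f : repmor M N) : stable_eq f f.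
Proof. exact: repmor_eq_stable. Qed.

Lemma stable_sym M N (f g : repmor M N) : stable_eq f g -> stable_eq g f.
Proof.
move=> [P [u [v [PP fg]]]]; exists P, u, (repmor_opp v); split=> // i x.
by rewrite -opprB fg.
Qed.

Lemma stable_trans M N (f g h : repmor M N) :
  stable_eq f g -> stable_eq g h -> stable_eq f h.
Proof.
move=> [P [u [v [PP fg]]]] [Q [w [z [QQ gh]]]].
exists (dsum P Q), (repmor_pair u w),
  (repmor_add (repmor_comp v (dsum_fst P Q)) (repmor_comp z (dsum_snd P Q))).
split=> [|i x /=]; first exact: proj_inj_dsum.
by rewrite -fg -gh addrA subrK.
Qed.

Lemma stable_cmp M N P (f f' : repmor M N) (g g' : repmor N P) :
  stable_eq f f' -> stable_eq g g' ->
  stable_eq (repmor_comp g f) (repmor_comp g' f').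
Proof.
move=> [T [u [v [TP ff']]]] [S [w [z [SP gg']]]].
apply: (@stable_trans _ _ _ (repmor_comp g f')).
  exists T, u, (repmor_comp g v); split=> // i x.
  by rewrite /= -ff' raddfB.
by exists S, (repmor_comp w f'), z; split=> // i x; rewrite /= -gg'.
Qed.

Lemma stable_1m M N (f : repmor M N) :
  stable_eq (repmor_comp (repmor_id N) f) f.
Proof. exact: stable_refl. Qed.

Lemma stable_m1 M N (f : repmor M N) :
  stable_eq (repmor_comp f (repmor_id M)) f.
Proof. exact: stable_refl. Qed.

Lemma stable_A M N P T (f : repmor M N) (g : repmor N P) (h : repmor P T) :
  stable_eq (repmor_comp h (repmor_comp g f)) (repmor_comp (repmor_comp h g) f).
Proof. exact: stable_refl. Qed.

End StableLaws.

Definition stable_category : category :=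
  @Category repmod repmor stable_eq repmor_id repmor_comp
    stable_refl stable_sym stable_trans stable_cmp stable_1m stable_m1 stable_A.

Definition indecomposable (M : repmod) :=
  ~ rep_zero M /\
  forall A B : repmod, @isomorphic rep_category M (dsum A B) ->
    rep_zero A \/ rep_zero B.

(* The zero module is projective and a summand of everything, so only nonzero  *)
(* projective summands are excluded.                                           *)
Definition no_projective_summand (M : repmod) :=
  forall P X : repmod, rep_projective P ->
    @isomorphic rep_category M (dsum P X) -> rep_zero P.

Section MorphismTypes.
Variables M N : repmod.
Implicit Type h : repmor M N.

Definition comp_split_mono h i :=
  @split_mono (mod_category L) (M i) (N i) (h i).

Definition comp_split_epi h i :=
  @split_epi (mod_category L) (M i) (N i) (h i).

Definition smonic h := forall i, comp_split_mono h i.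

Definition sepic h := forall i, comp_split_epi h i.

Definition sirreducible h :=
  @irreducible rep_category M N h /\
  exists i0,
    unique (fun i => ~ comp_split_mono h i /\ ~ comp_split_epi h i) i0 /\
    @irreducible (mod_category L) (M i0) (N i0) (h i0).

(* The morphisms h for which the stable types below are defined. *)
Definition stably_admissible h :=
  [/\ @irreducible stable_category M N h,
      indecomposable M \/ indecomposable N,
      no_projective_summand M &
      no_projective_summand N].

Definition stably_smonic h := stably_admissible h /\ smonic h.
Definition stably_sepic h := stably_admissible h /\ sepic h.
Definition stably_sirreducible h := stably_admissible h /\ sirreducible h.

End MorphismTypes.
End Repetitive.

(* Main.v *)
(** An endomorphism of M (or N) factoring through a projective is nilpotent,
    because its Fitting image is a projective summand. Hence a stable split mono
    out of M splits, a stable split epi onto N splits, and h is already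
    irreducible in the category of modules over the repetitive algebra.

    Any factorization h_i0 = v u through a module Z glues to a factorization of
    h through the module equal to M below i0, to Z at i0 and to N above i0. Let
    i0 be the last index at which h is not a split mono. Gluing at i0 shows that
    h_i is a split epi for i < i0, and that h_i0 is irreducible unless it is a
    split epi. In the latter case h is not mono, hence it is epi by its image
    factorization, and since h_i is a split mono for i > i0, h is sepic. *)

From HB Require Import structures.
Require Import Defs.
From mathcomp Require Import all_boot all_order all_algebra all_field.
From mathcomp Require Import boolp freeg ring.

Set Implicit Arguments.
Unset Strict Implicit.
Unset Printing Implicit Defensive.

Import Order.TTheory GRing.Theory Num.Theory.
Local Open Scope ring_scope.

(** * Images of linear maps as finitely generated modules *)

Section LinearImage.
Variables (R : nzRingType) (V W : lmodType R) (phi : {linear V -> W}).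

(** Made boolean classically, so that the image is a subtype inheriting the module structure. *)
Definition in_image : pred W := fun y => `[< exists x, phi x = y >].

Lemma in_image_closed : submod_closed in_image.
Proof.
split; first by apply/asboolP; exists 0; rewrite raddf0.
move=> a x y /asboolP[u <-] /asboolP[v <-].
by apply/asboolP; exists (a *: u + v); rewrite linearP.
Qed.

HB.instance Definition _ :=
  GRing.isSubmodClosed.Build R W in_image in_image_closed.

Definition image_mod := {y : W | in_image y}.
HB.instance Definition _ := SubChoice.on image_mod.
HB.instance Definition _ := [SubChoice_isSubLmodule of image_mod by <:].

Definition image_incl : {linear image_mod -> W} := \val.

Lemma image_incl_inj : injective image_incl.
Proof. exact: val_inj. Qed.

Section Corestrict.
Variables (A : lmodType R) (g : {linear A -> W}).
Hypothesis gP : forall x, in_image (g x).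

Definition corestrict_fun (x : A) : image_mod := exist _ (g x) (gP x).

Lemma corestrict_linear : linear corestrict_fun.
Proof. by move=> a x y; apply: val_inj; rewrite /= !linearP. Qed.

HB.instance Definition _ :=
  GRing.isLinear.Build _ _ _ _ corestrict_fun corestrict_linear.

Definition corestrict : {linear A -> image_mod} := corestrict_fun.

Lemma corestrictE x : image_incl (corestrict x) = g x.
Proof. by []. Qed.
End Corestrict.

Lemma in_imageP x : in_image (phi x).
Proof. by apply/asboolP; exists x. Qed.

Definition image_proj : {linear V -> image_mod} := corestrict in_imageP.

Lemma image_proj_surj y : exists x, image_proj x = y.
Proof.
case: y => y yP; have [x xy] := asboolP _ yP.
by exists x; apply: val_inj.
Qed.

Lemma image_fg : finitely_generated V -> finitely_generated image_mod.
Proof.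
move=> [n [g gP]]; exists n, (fun i => image_proj (g i)) => y.
have [x <-] := image_proj_surj y; have [c ->] := gP x; exists c.
by rewrite linear_sum; apply: eq_bigr => i _; rewrite linearZ.
Qed.

End LinearImage.

Section RepetitiveModules.
Variables (k : fieldType) (L : falgType k).
Local Notation "g ∘ f" := (repmor_comp g f) (at level 40).

(** Elements are integer combinations of pure tensors, and closure under differences yields
    negatives, sums and multiples. *)
Lemma tens_ind (V : lmodType L) (P : tens V -> Prop) :
  P 0 -> (forall s t, P s -> P t -> P (s - t)) ->
  (forall q m, P (tpure q m)) -> forall t, P t.
Proof.
move=> P0 PB Pp t; have [x ->] := tproj_surj t.
have PN s : P s -> P (- s) by move=> Ps; rewrite -sub0r; apply: PB.
have PD s r : P s -> P r -> P (s + r).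
  by move=> Ps Pr; rewrite -[r]opprK; apply/PB/PN.
have Pn s n : P s -> P (s *+ n).
  by move=> Ps; elim: n => [|n IH]; rewrite ?mulr0n // mulrS; apply: PD.
rewrite -[x]freeg_sumE raddf_sum; apply: big_rec => // [[q m]] s _ Ps.
apply: PD => //; rewrite -[coeff _ _]intz -freegU_mulz raddfMz.
by case: (coeff _ _) => n; rewrite ?NegzE ?mulrNz; [|apply: PN];
  rewrite -pmulrn; apply/Pn/Pp.
Qed.

(** * Image factorization over the repetitive algebra *)

Section Image.
Variables (M N : repmod L) (h : repmor M N).

Let incl i := image_incl (h i).

(** For a pure tensor of [q] with the image of [x], compatibility of [h] with the structure maps
    gives the preimage [rmap M i (tpure q x)]. *)
Lemma image_rmap_in i (t : tens (image_mod (h i))) :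
  in_image (h (i + 1)) ((rmap N i \o tmap (incl i)) t).
Proof.
move: t; apply: tens_ind => [|s t /asboolP[x xs] /asboolP[y yt]|q m].
- by apply/asboolP; exists 0; rewrite [LHS]raddf0 [RHS]raddf0.
- apply/asboolP; exists (x - y).
  transitivity (h (i + 1) x - h (i + 1) y); first exact: raddfB.
  by rewrite xs yt raddfB.
- have [x <-] := image_proj_surj m; apply/asboolP.
  by exists (rmap M i (tpure q x)); rewrite mcompP /= !tmapE.
Qed.

Definition image_comp (i : int) : fgmod L :=
  FgMod (image_fg (h i) (fgmodP (M i))).

Definition image_rmap i : {linear tens (image_comp i) -> image_comp (i + 1)} :=
  corestrict (@image_rmap_in i).

(** The inclusion into [N] is injective and reduces the relation to the one for [N]. *)
Lemma image_rmap_comp i (t : tens (tens (image_comp i))) :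
  image_rmap (i + 1) (tmap (image_rmap i) t) = 0.
Proof.
apply: (@image_incl_inj _ _ _ (h (i + 1 + 1))).
rewrite corestrictE raddf0 -(rmap_comp (tmap (tmap (incl i)) t)) /=.
congr (rmap _ _ _); rewrite -[LHS]tmap_comp -[RHS]tmap_comp.
exact: tmap_ext.
Qed.

Lemma image_fin : exists s : seq int, forall i, i \notin s ->
  forall x : image_comp i, x = 0.
Proof.
have [s sP] := rcomp_fin N; exists s => i si x.
by apply: image_incl_inj; rewrite (sP i si (image_incl (h i) x)) raddf0.
Qed.

Definition rep_image : repmod L := RepMod image_rmap_comp image_fin.

Lemma rep_incl_proof i (t : tens (rep_image i)) :
  incl (i + 1) (rmap rep_image i t) = rmap N i (tmap (incl i) t).
Proof. by []. Qed.

Definition rep_incl : repmor rep_image N := RepMor rep_incl_proof.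

Lemma rep_proj_proof i (t : tens (M i)) :
  image_proj (h (i + 1)) (rmap M i t) =
  rmap rep_image i (tmap (image_proj (h i)) t).
Proof.
apply: image_incl_inj; rewrite /= mcompP; congr (rmap _ _ _).
by rewrite -[RHS]tmap_comp; apply: tmap_ext.
Qed.

Definition rep_proj : repmor M rep_image :=
  @RepMor _ _ M rep_image (fun i => image_proj (h i)) rep_proj_proof.

Lemma rep_incl_inj i : injective (rep_incl i).
Proof. exact: image_incl_inj. Qed.

Lemma rep_proj_surj i y : exists x, rep_proj i x = y.
Proof. exact: image_proj_surj. Qed.

End Image.

(** * Idempotents and retracts *)

Definition repmor_sub (M N : repmod L) (f g : repmor M N) : repmor M N :=
  repmor_add f (repmor_opp g).

Lemma repmor_subE (M N : repmod L) (f g : repmor M N) i x :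
  repmor_sub f g i x = f i x - g i x.
Proof. by []. Qed.

(** The complement [B] is the image of [1 - e]. *)
Lemma idempotent_split (M : repmod L) (e : repmor M M) :
  (forall i x, e i (e i x) = e i x) ->
  exists B, @isomorphic (rep_category L) M (dsum (rep_image e) B).
Proof.
move=> ee; pose e' := repmor_sub (repmor_id M) e.
exists (rep_image e'), (repmor_pair (rep_proj e) (rep_proj e')).
exists (repmor_add (rep_incl e ∘ dsum_fst _ _) (rep_incl e' ∘ dsum_snd _ _)).
split=> i; first by move=> x /=; rewrite addrC subrK.
move=> [y z]; have [y' <-] := rep_proj_surj y; have [z' <-] := rep_proj_surj z.
apply: injective_projections; apply: rep_incl_inj => /=.
  by rewrite /opp_map !raddfD !raddfN /= !ee subrr addr0.
rewrite /opp_map !raddfD !raddfN /= !ee.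
by rewrite subrr addr0 [LHS]addrAC subrr add0r.
Qed.

Lemma retract_projective (P A : repmod L) (r : repmor P A) (s : repmor A P) :
  (forall i x, r i (s i x) = x) -> rep_projective P -> rep_projective A.
Proof.
move=> rs Pp X Y g f gP; have [l lE] := Pp X Y g (f ∘ r) gP.
by exists (l ∘ s) => i x; have /= -> := lE i (s i x); rewrite rs.
Qed.

(** * Fitting decomposition of an endomorphism *)

Section Fitting.
Variables (M : repmod L) (c : repmor M M).

Definition kscale_fun (a : k) i (x : M i) : M i := a%:A *: x.

Lemma kscale_linear a i : linear (@kscale_fun a i).
Proof.
move=> b x y; rewrite /kscale_fun scalerDr !scalerA.
by rewrite mulr_algl mulr_algr.
Qed.

HB.instance Definition _ a i :=
  GRing.isLinear.Build _ _ _ _ (@kscale_fun a i) (@kscale_linear a i).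

(** The two actions of [k] on the dual bimodule coincide, so a scalar crosses the tensor sign. *)
Lemma kscale_proof a i (t : tens (M i)) :
  kscale_fun a (rmap M i t) = rmap M i (tmap (@kscale_fun a i) t).
Proof.
rewrite /kscale_fun -linearZ; congr (rmap _ _ _); move: t.
apply: (@tens_eq _ _ _ _ ( *:%R a%:A)) => q m.
rewrite /= tpureZ tmapE /kscale_fun -tpureM; congr (tpure _ _).
by apply/lfunP => x; rewrite lactE ractE mulr_algl mulr_algr.
Qed.

Definition kscale a : repmor M M := RepMor (@kscale_proof a).

(** The products of a [k]-basis of [L] with generators over [L] span over [k]. *)
Lemma fg_over_field i : exists n (y : 'I_n.+1 -> M i),
  forall x, exists v : 'rV[k]_n.+1, x = \sum_j (v 0 j)%:A *: y j.
Proof.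
have [m [g gP]] := fgmodP (M i).
have [n [y yP]] : exists n (y : 'I_n -> M i),
    forall x, exists v : 'I_n -> k, x = \sum_j (v j)%:A *: y j.
  pose b := vbasis {:L}.
  pose T := ('I_m * 'I_(\dim {:L}))%type.
  pose p (j : 'I_#|{: T}|) : T := enum_val j.
  exists #|{: T}|, (fun j => b`_(p j).2 *: g (p j).1) => x.
  have [d ->] := gP x.
  exists (fun j => coord b (p j).2 (d (p j).1)).
  pose F (q : T) := (coord b q.2 (d q.1))%:A *: (b`_q.2 *: g q.1).
  transitivity (\sum_(q : T) F q); last first.
    by apply/reindex/onW_bij/enum_val_bij.
  rewrite -(pair_bigA _ (fun a c => F (a, c))) /=.
  apply: eq_bigr => a _; rewrite {1}(coord_vbasis (memvf (d a))) scaler_suml.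
  by apply: eq_bigr => j _; rewrite /F /= scalerA mulr_algl.
(* A zero generator is added at [ord0], so that square matrices of size [n.+1] form a nonzero
   ring. *)
exists n, (fun j => if unlift ord0 j is Some j' then y j' else 0) => x.
have [v ->] := yP x.
exists (\row_j if unlift ord0 j is Some j' then v j' else 0).
rewrite big_ord_recl unlift_none scaler0 add0r.
by apply: eq_bigr => j _; rewrite mxE liftK.
Qed.

Section Matrix.
Variables (i : int) (n : nat) (y : 'I_n.+1 -> M i).
Hypothesis yP : forall x, exists v : 'rV[k]_n.+1, x = \sum_j (v 0 j)%:A *: y j.

Definition combi (v : 'rV[k]_n.+1) : M i := \sum_j (v 0 j)%:A *: y j.

Lemma combiP a u v : combi (a *: u + v) = a%:A *: combi u + combi v.
Proof.
rewrite /combi scaler_sumr -big_split; apply: eq_bigr => j _ /=.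
by rewrite !mxE scalerDl scalerDl scalerA mulr_algl scalerA.
Qed.

Lemma combi0 : combi 0 = 0.
Proof. by rewrite /combi big1 // => j _; rewrite mxE !scale0r. Qed.

(** The [y j] span but may be dependent, so [C] records a choice of coordinates for each
    [c i (y j)]. *)
Lemma combi_matrix : exists C : 'M[k]_n.+1,
  forall v, c i (combi v) = combi (v *m C).
Proof.
have [F FP] := choice (fun j => yP (c i (y j))).
exists (\matrix_(j, l) F j 0 l) => v.
rewrite /combi linear_sum; under eq_bigr do rewrite linearZ /= FP scaler_sumr.
rewrite exchange_big; apply: eq_bigr => l _ /=.
rewrite !mxE !scaler_suml; apply: eq_bigr => j _.
by rewrite scalerA mxE mulr_algl scalerA.
Qed.

(** [D] is [p] evaluated at [c] by Horner's scheme, as an endomorphism of all of [M], although [C]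
    describes [c] only at [i]. *)
Lemma combi_horner (C : 'M[k]_n.+1) (p : {poly k}) :
  (forall v, c i (combi v) = combi (v *m C)) ->
  exists D : repmor M M, (forall j x, c j (D j x) = D j (c j x)) /\
    forall v, D i (combi v) = combi (v *m horner_mx C p).
Proof.
move=> CP; elim/poly_ind: p => [|p a [D [cD DP]]].
  exists (repmor_null M M); split=> [j x|v]; first by rewrite /= raddf0.
  by rewrite rmorph0 mulmx0 combi0.
exists (repmor_add (D ∘ c) (kscale a)); split=> [j x|v] /=.
  by rewrite linearD /= cD /kscale_fun linearZ.
rewrite CP DP /kscale_fun [p * _]mulrC rmorphD rmorphM /= horner_mx_X.
rewrite horner_mx_C addrC -combiP; congr combi.
by rewrite mulmxDr mul_mx_scalar addrC mulmxA.
Qed.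

End Matrix.

(** Write the characteristic polynomial as [q X^N] with [q = s X + a] and [a] nonzero. Modulo it,
    [X^N = - a^-1 s X^(N+1)], which Cayley-Hamilton transfers to [c]; [D] is [- a^-1 s] evaluated at
    [c]. *)
Lemma fitting_at i : exists N (D : repmor M M),
  (forall j x, c j (D j x) = D j (c j x)) /\
  forall x, iter N (c i) x = D i (iter N.+1 (c i) x).
Proof.
have [n [y yP]] := fg_over_field i; have [C CP] := combi_matrix yP.
have p0 : char_poly C != 0 by apply/monic_neq0/char_poly_monic.
have [N [q]] := multiplicity_XsubC (char_poly C) 0.
rewrite p0 polyC0 subr0 /= => q0 pE.
have [s [a qE]] : exists s a, q = s * 'X + a%:P.
  exists (\poly_(j < size q) q`_j.+1), q`_0.
  apply/polyP => -[|j]; rewrite coefD coefMX coefC ?add0r //= coef_poly addr0.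
  case: ltnP => // qj; rewrite nth_default //; exact: (leqW qj).
have a0 : a != 0 by move: q0; rewrite qE /root !hornerE.
have E : C ^+ N = C ^+ N.+1 * horner_mx C (- a^-1 *: s).
  have XE : 'X^N = 'X^(N.+1) * (- a^-1 *: s) + a^-1%:P * char_poly C.
    have ->: - a^-1 *: s = - a^-1%:P * s by rewrite -polyCN mul_polyC.
    have aa : a^-1%:P * a%:P = 1 :> {poly k} by rewrite -polyCM mulVf.
    rewrite pE qE exprS -[LHS]mul1r -aa; ring.
  have := congr1 (horner_mx C) XE.
  rewrite rmorphD !rmorphM /= Cayley_Hamilton mulr0 addr0.
  by rewrite !rmorphXn /= horner_mx_X.
have [D [cD DP]] := combi_horner (- a^-1 *: s) CP.
exists N, D; split=> // x; have [v ->] := yP x.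
have iterE m u : iter m (c i) (combi y u) = combi y (u *m C ^+ m).
  elim: m => [|m IH]; first by rewrite mulmx1.
  by rewrite iterS IH CP -mulmxA exprSr.
by rewrite -/(combi y v) iterE CP DP [in LHS]E exprSr !mulmxA.
Qed.

Let comm (D : repmor M M) := forall i x, c i (D i x) = D i (c i x).

Lemma commute_iter i (D : repmor M M) n x :
  comm D -> D i (iter n (c i) x) = iter n (c i) (D i x).
Proof. by move=> cD; elim: n => //= n IH; rewrite -cD IH. Qed.

Lemma fitting_step i (D : repmor M M) N n x : comm D ->
  (forall x, iter N (c i) x = D i (iter N.+1 (c i) x)) ->
  iter (N + n) (c i) x = D i (iter (N + n).+1 (c i) x).
Proof. by move=> cD ND; rewrite -addSn !iterD ND. Qed.

Lemma fitting_at_all (s : seq int) : exists N (D : repmor M M), comm D /\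
  forall i, i \in s -> forall x, iter N (c i) x = D i (iter N.+1 (c i) x).
Proof.
elim: s => [|i s [N [D [cD ND]]]].
  by exists 0, (repmor_null M M); split=> // i x /=; rewrite raddf0.
have [N' [D' [cD' ND']]] := fitting_at i.
(* (1 - c D) (1 - c D') = 1 - c (D + D' - c D D') kills the images of both. *)
exists (N + N')%N, (repmor_sub (repmor_add D D') (c ∘ D ∘ D')).
split=> [j x|j]; first by rewrite /= /opp_map !linearD !linearN /= !(cD, cD').
rewrite inE => /orP[/eqP ->|js] x.
  have E y : iter (N + N') (c i) y = D' i (iter (N + N').+1 (c i) y).
    by rewrite addnC; apply: fitting_step.
  rewrite repmor_subE /=; have /= <- := E x.
  by rewrite cD addrC addKr.
have E y : iter (N + N') (c j) y = D j (iter (N + N').+1 (c j) y).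
  exact: (fitting_step _ _ cD (ND j js)).
have D'E : D' j (iter (N + N').+1 (c j) x) = iter (N + N').+1 (c j) (D' j x).
  exact: commute_iter.
rewrite repmor_subE /=; have /= -> := D'E; have /= <- := E x.
by have /= <- := E (D' j x); rewrite addrK.
Qed.

Lemma fitting : exists N (D : repmor M M), comm D /\
  forall i x, iter N (c i) x = D i (iter N.+1 (c i) x).
Proof.
have [s sP] := rcomp_fin M; have [N [D [cD ND]]] := fitting_at_all s.
exists N, D; split=> // i x; have [/ND->//|si] := boolP (i \in s).
by rewrite (sP i si x) [LHS](sP i si) [RHS](sP i si).
Qed.

Definition repmor_iter (f : repmor M M) n : repmor M M :=
  iter n (repmor_comp f) (repmor_id M).

Lemma repmor_iterE f n i x : repmor_iter f n i x = iter n (f i) x.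
Proof. by elim: n => //= n IH; rewrite IH. Qed.

(** [c d] is the Fitting projection along the kernel of [c^N]. Having [c] as a factor, it factors
    through a projective whenever [c] does. *)
Lemma fitting_idempotent : exists N (d : repmor M M),
  (forall i x, c i (d i (c i (d i x))) = c i (d i x)) /\
  (forall i x, c i (d i x) = 0 -> iter N (c i) x = 0).
Proof.
have [N [D [cD ND]]] := fitting.
(* [e] is idempotent because [c^N w = c^N]. *)
pose w := D ∘ c; pose e := repmor_iter w N.
have witer i n x : iter n (w i) x = iter n (D i) (iter n (c i) x).
  elim: n x => //= n IH x; rewrite IH; congr (D i _).
  by elim: {IH} n (iter n (c i) x) => //= n IH y; rewrite cD IH.
have cw i m x : iter N (c i) (iter m (w i) x) = iter N (c i) x.
  by elim: m => //= m <-; rewrite -commute_iter // -iterSr -ND.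
have ew i m x : e i (iter m (w i) x) = e i x.
  by rewrite !repmor_iterE [LHS]witer cw -witer.
have we i x : c i (D i (e i x)) = e i x.
  by rewrite cD -[RHS](ew i 1) !repmor_iterE -iterSr.
exists N, (D ∘ e); split=> i x /=; rewrite !we.
  by rewrite [X in e i X]repmor_iterE ew.
have iter0 n : iter n (c i) 0 = 0 by elim: n => //= n ->; rewrite raddf0.
by move=> ex0; rewrite -(cw i N) -(repmor_iterE w) -/e ex0.
Qed.

(** The inverse of [1 - c] is the geometric series [1 + c + ... + c^(N-1)], built by
    [w := 1 + c w]. *)
Lemma nilpotent_sub_invertible N : (forall i x, iter N (c i) x = 0) ->
  exists w : repmor M M, forall i x,
    w i (x - c i x) = x /\ w i x - c i (w i x) = x.
Proof.
move=> cN; suff [w [cw wE]] : exists w : repmor M M, comm w /\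
    forall i x, w i x - c i (w i x) = x - iter N (c i) x.
  exists w => i x; split; last by rewrite wE cN subr0.
  by rewrite linearB /= -cw wE cN subr0.
elim: N {cN} => [|N [w [cw wE]]].
  exists (repmor_null M M); split=> i x /=; first by rewrite raddf0.
  by rewrite linear0 subr0 subrr.
exists (repmor_add (repmor_id M) (c ∘ w)); split=> i x /=.
  by rewrite linearD /= !cw.
by rewrite linearD /= opprD addrACA -linearB /= wE linearB /= addrA subrK.
Qed.

End Fitting.

(** * From stable splittings to splittings of modules *)

Lemma sub_invertible (M P : repmod L) (a : repmor M P) (b : repmor P M) :
  no_projective_summand M -> rep_projective P ->
  exists w : repmor M M, forall i x,
    w i (x - b i (a i x)) = x /\ w i x - b i (a i (w i x)) = x.
Proof.
move=> nM Pp; have [N [d [ee eN]]] := fitting_idempotent (b ∘ a).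
apply: (@nilpotent_sub_invertible _ (b ∘ a) N) => i x; apply: eN.
(* The image of [e] is a summand of [M] and a retract of [P], hence zero; so [e] vanishes and
   [b ∘ a] is nilpotent. *)
pose e := b ∘ a ∘ d; have [B isoB] := @idempotent_split _ e ee.
have eP : rep_projective (rep_image e).
  apply: (@retract_projective P _ (rep_proj e ∘ b) (a ∘ d ∘ rep_incl e)) Pp.
  move=> j y; have [y' <-] := rep_proj_surj y; apply: rep_incl_inj => /=.
  by have /= -> := ee j (b j (a j (d j y'))); have /= -> := ee j y'.
rewrite -[LHS]/(rep_incl e i (rep_proj e i x)).
by rewrite (nM _ _ eP isoB i (rep_proj e i x)) raddf0.
Qed.

(** A stable retraction [g] gives [g u = 1 - b a] with [b a] through a projective; the inverse of
    [1 - b a] corrects [g]. *)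
Lemma stable_split_mono (M N : repmod L) (u : repmor M N) :
  no_projective_summand M ->
  @split_mono (stable_category L) M N u -> @split_mono (rep_category L) M N u.
Proof.
move=> nM [g /stable_sym [P [a [b [[Pp _] E]]]]].
have [w wE] := sub_invertible a b nM Pp; exists (w ∘ g) => i x /=.
by have [wx _] := wE i x; rewrite -[RHS]wx -E subKr.
Qed.

Lemma stable_split_epi (M N : repmod L) (v : repmor M N) :
  no_projective_summand N ->
  @split_epi (stable_category L) M N v -> @split_epi (rep_category L) M N v.
Proof.
move=> nN [g /stable_sym [P [a [b [[Pp _] E]]]]].
have [w wE] := sub_invertible a b nN Pp; exists (g ∘ w) => i x /=.
by have [_ wx] := wE i x; rewrite -[RHS]wx -E subKr.
Qed.

Lemma stable_irreducible (M N : repmod L) (h : repmor M N) :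
  no_projective_summand M -> no_projective_summand N ->
  @irreducible (stable_category L) M N h -> @irreducible (rep_category L) M N h.
Proof.
move=> nM nN [nm ne hP]; split.
- by move=> [g gE]; apply: nm; exists g; apply: repmor_eq_stable.
- by move=> [g gE]; apply: ne; exists g; apply: repmor_eq_stable.
- move=> Z u v hE; have [] := hP Z u v (repmor_eq_stable hE).
    by left; apply: stable_split_mono.
  by right; apply: stable_split_epi.
Qed.

(** * Gluing a factorization of one component to a factorization of [h] *)

Section Glue.
Variables (M N : repmod L) (h : repmor M N) (i0 : int).

(* [fleft_inv] and [fright_inv] are meaningful only below, resp. above, [i0];
   carrying them at every index lets the structure maps of the glued module be
   defined without transport along equalities of indices. *)
Record factorization i := Factorization {
  fmid : fgmod L;
  fleft : {linear M i -> fmid};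
  fright : {linear fmid -> N i};
  fleft_inv : {linear fmid -> M i};
  fright_inv : {linear N i -> fmid};
  fright_left : forall x, fright (fleft x) = h i x;
  fleftK : (i < i0) -> cancel fleft fleft_inv;
  fleft_invK : (i < i0) -> cancel fleft_inv fleft;
  frightK : (i0 < i) -> cancel fright fright_inv;
  fright_invK : (i0 < i) -> cancel fright_inv fright
}.

Section GlueMap.
Variable F : forall i, factorization i.

Local Notation Z i := (fmid (F i)).
Local Notation u i := (fleft (F i)).
Local Notation v i := (fright (F i)).
Local Notation p i := (fleft_inv (F i)).
Local Notation q i := (fright_inv (F i)).

(** The inverses are used only where they are genuine: [p i] for [i < i0], and [q (i + 1)] for
    [i0 <= i]. *)
Definition glue_rmap i : {linear tens (Z i) -> Z (i + 1)} :=
  if (i < i0) then (u (i + 1) \o rmap M i \o tmap (p i) : {linear _ -> _})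
  else (q (i + 1) \o rmap N i \o tmap (v i) : {linear _ -> _}).

Lemma glue_rmapL i t : (i < i0) ->
  glue_rmap i t = u (i + 1) (rmap M i (tmap (p i) t)).
Proof. by rewrite /glue_rmap => ->. Qed.

Lemma glue_rmapR i t : (i0 <= i) ->
  glue_rmap i t = q (i + 1) (rmap N i (tmap (v i) t)).
Proof. by rewrite /glue_rmap ltNge => ->. Qed.

(** Below [i0], [p] cancels [u]. From [i0] on, [v u = h] commutes with the structure maps and [q]
    cancels [v]. *)
Lemma glue_left i (t : tens (M i)) :
  u (i + 1) (rmap M i t) = glue_rmap i (tmap (u i) t).
Proof.
case: (ltP i i0) => ii0.
  rewrite glue_rmapL // -[tmap _ (tmap _ t)]tmap_comp; congr (u _ (rmap _ _ _)).
  by rewrite -[LHS]tmap_id; apply: tmap_ext => x; rewrite /= fleftK.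
rewrite glue_rmapR // -[tmap _ (tmap _ t)]tmap_comp.
rewrite (@tmap_ext _ _ _ _ _ (h i)); last exact: fright_left.
by rewrite -mcompP -(fright_left (F (i + 1))) frightK // ltzD1.
Qed.

Lemma glue_right i (t : tens (Z i)) :
  v (i + 1) (glue_rmap i t) = rmap N i (tmap (v i) t).
Proof.
case: (ltP i i0) => ii0; last first.
  by rewrite glue_rmapR // fright_invK // ltzD1.
rewrite glue_rmapL // fright_left mcompP; congr (rmap _ _ _).
rewrite -[LHS]tmap_comp; apply: tmap_ext => x.
by rewrite /= -(fright_left (F i)) fleft_invK.
Qed.

Lemma glue_rmap_comp i (t : tens (tens (Z i))) :
  glue_rmap (i + 1) (tmap (glue_rmap i) t) = 0.
Proof.
case: (ltP (i + 1) i0) => ii0.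
  have lt_i : (i < i0) by apply: lt_trans ii0; rewrite ltzD1.
  rewrite glue_rmapL // -[tmap _ (tmap _ t)]tmap_comp.
  rewrite (@tmap_ext _ _ _ _ _ (rmap M i \o tmap (p i))).
    by rewrite [tmap _ t]tmap_comp /= rmap_comp linear0.
  by move=> x; rewrite /= glue_rmapL // fleftK.
(* This includes [i = i0 - 1], where the first map passes through [M]: [glue_right] moves it to [N]
   in either case. *)
rewrite glue_rmapR // -[tmap _ (tmap _ t)]tmap_comp.
rewrite (@tmap_ext _ _ _ _ _ (rmap N i \o tmap (v i))).
  by rewrite [tmap _ t]tmap_comp /= rmap_comp linear0.
by move=> x; rewrite /= glue_right.
Qed.

Lemma glue_fin : exists s : seq int,
  forall i, i \notin s -> forall x : Z i, x = 0.
Proof.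
have [s sP] := rcomp_fin M; have [r rP] := rcomp_fin N.
exists (i0 :: s ++ r) => i; rewrite inE mem_cat !negb_or.
move=> /and3P[ni /sP M0 /rP N0] x; case: (ltgtP i i0) ni => // ii0 _.
  by rewrite -(fleft_invK ii0 x) (M0 (p i x)) raddf0.
by rewrite -(frightK ii0 x) (N0 (v i x)) raddf0.
Qed.

Definition glue : repmod L := RepMod glue_rmap_comp glue_fin.

Definition glue_in : repmor M glue :=
  @RepMor _ _ M glue (fun i => u i) glue_left.
Definition glue_out : repmor glue N :=
  @RepMor _ _ glue N (fun i => v i) glue_right.

End GlueMap.

Lemma factorization_extend (d : factorization i0) :
  exists F : forall i, factorization i, F i0 = d.
Proof.
have T i : i0 <> i -> factorization i.
  move=> ne; case: (ltgtP i i0) => [li|gi|/esym//].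
    by exists (M i) idfun (h i) idfun \0 => //; rewrite (lt_gtF li).
  by exists (N i) (h i) idfun \0 idfun => //; rewrite (lt_gtF gi).
(* [d] is transported along a proof of [i0 = i]; uniqueness of such proofs makes the value at [i0]
   exactly [d]. *)
exists (fun i => match @eqP _ i0 i with
                 | ReflectT e => eq_rect i0 factorization d i e
                 | ReflectF ne => T i ne
                 end).
by case: eqP => // e; rewrite (eq_axiomK e).
Qed.

Lemma split_mono_comp (X Y : repmod L) (f : repmor X Y) i :
  @split_mono (rep_category L) X Y f -> comp_split_mono f i.
Proof. by move=> [g gf]; exists (g i); apply: gf. Qed.

Lemma split_epi_comp (X Y : repmod L) (f : repmor X Y) i :
  @split_epi (rep_category L) X Y f -> comp_split_epi f i.
Proof. by move=> [g gf]; exists (g i); apply: gf. Qed.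

(** Irreducibility splits [glue_in] or [glue_out], and splittings are read componentwise. Up to
    isomorphism, [glue_in] is [h] above [i0] and [glue_out] is [h] below it. *)
Lemma irreducible_factor (Z : fgmod L) (u : {linear M i0 -> Z})
    (v : {linear Z -> N i0}) :
  @irreducible (rep_category L) M N h -> (forall x, h i0 x = v (u x)) ->
  (@split_mono (mod_category L) (M i0) Z u /\
     forall i, (i0 < i) -> comp_split_mono h i) \/
  (@split_epi (mod_category L) Z (N i0) v /\
     forall i, (i < i0) -> comp_split_epi h i).
Proof.
move=> [_ _ hP] hE.
(* At [i0] the inverse laws are vacuous, so zero maps fill the inverse fields. *)
have lt_absurd (A : Prop) : (i0 < i0) -> A by rewrite ltxx.
have [F F0] := @factorization_extend (@Factorization i0 Z u v \0 \0
  (fun x => esym (hE x)) (lt_absurd _) (lt_absurd _)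
  (lt_absurd _) (lt_absurd _)).
have [i x|uP|vP] := hP (glue F) (glue_in F) (glue_out F).
- by rewrite /= fright_left.
- left; split.
    by have := split_mono_comp i0 uP; rewrite /comp_split_mono /= F0.
  move=> i ii0; have [/= g gu] := split_mono_comp i uP.
  exists (g \o fright_inv (F i) : {linear _ -> _}) => x /=.
  by rewrite -(fright_left (F i)) frightK //; apply: gu.
- right; split.
    by have := split_epi_comp i0 vP; rewrite /comp_split_epi /= F0.
  move=> i ii0; have [/= g vg] := split_epi_comp i vP.
  exists (fleft_inv (F i) \o g : {linear _ -> _}) => x /=.
  by rewrite -(fright_left (F i)) fleft_invK //; apply: vg.
Qed.

End Glue.

(** * The trichotomy, read at the last component that is not a split mono *)

Lemma seq_max (P : int -> Prop) (s : seq int) : (exists2 i, i \in s & P i) ->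
  exists2 i, P i & forall j, j \in s -> P j -> (j <= i).
Proof.
elim: s => [[]//|i s IH exP].
have [/IH[m Pm mP]|nP] := pselect (exists2 j, j \in s & P j).
  have [[Pi mi]|nPi] := pselect (P i /\ (m <= i)).
    exists i => // j; rewrite inE => /orP[/eqP->//|js Pj].
    exact: le_trans (mP j js Pj) mi.
  exists m => // j; rewrite inE => /orP[/eqP-> Pi|]; last exact: mP.
  by case: (leP i m) => // /ltW mi; case: nPi.
have {exP} Pi : P i.
  by have [j] := exP; rewrite inE => /orP[/eqP->//|js Pj]; case: nP; exists j.
exists i => // j; rewrite inE => /orP[/eqP->//|js Pj].
by case: nP; exists j.
Qed.

Section Trichotomy.
Variables (M N : repmod L) (h : repmor M N).
Hypothesis h_irr : @irreducible (rep_category L) M N h.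

(** In the image factorization, either the projection is a split mono or the inclusion is a split
    epi. *)
Lemma irreducible_inj_surj :
  (forall i, injective (h i)) \/ (forall i y, exists x, h i x = y).
Proof.
have [_ _ hP] := h_irr.
have [//|[g gP]|[g gP]] := hP (rep_image h) (rep_proj h) (rep_incl h).
  left=> i x y hxy; have pxy : rep_proj h i x = rep_proj h i y.
    exact: (@rep_incl_inj _ _ h i).
  by have := gP i x; rewrite /= pxy => <-; apply: gP.
by right=> i y; have [x xg] := rep_proj_surj (g i y); exists x;
  rewrite -[RHS](gP i) /= -xg.
Qed.

Lemma split_epi_inj_mono i :
  injective (h i) -> comp_split_epi h i -> comp_split_mono h i.
Proof. by move=> hI [s hs]; exists s => x; apply: hI; apply: hs. Qed.

Lemma split_mono_surj_epi i :
  (forall y, exists x, h i x = y) -> comp_split_mono h i -> comp_split_epi h i.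
Proof.
move=> hS [r rh]; exists r => y; have [x <-] := hS y.
by congr (h i _); apply: rh.
Qed.

(** Where [M i] is zero, [h i] is a split mono, so the exceptional indices lie in a finite list. *)
Lemma last_not_split_mono : ~ smonic h -> exists i0,
  ~ comp_split_mono h i0 /\ forall i, (i0 < i) -> comp_split_mono h i.
Proof.
move=> /existsNP[j0 nj0]; have [s sP] := rcomp_fin M.
have in_s i : ~ comp_split_mono h i -> i \in s.
  move=> ni; apply: contraT => /sP M0; case: ni.
  by exists (\0 : {linear N i -> M i}) => x; rewrite [RHS]M0 [LHS]M0.
have [|i0 ni0 i0P] := @seq_max (fun i => ~ comp_split_mono h i) s.
  by exists j0 => //; apply: in_s.
exists i0; split=> // i ii0; apply: contrapT => ni.
by move: ii0; rewrite ltNge (i0P i (in_s i ni) ni).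
Qed.

Lemma irreducible_trichotomy : smonic h \/ sepic h \/ sirreducible h.
Proof.
have [|/last_not_split_mono[i0 [ni0 hi0]]] := pselect (smonic h); first by left.
right; have [|/existsNP[i1 ni1]] := pselect (sepic h); first by left.
have factor := @irreducible_factor M N h i0 _ _ _ h_irr.
(* The factorization of [h i0] as itself followed by the identity; its first alternative contradicts
   [ni0]. *)
have hepi i : (i < i0) -> comp_split_epi h i.
  by have [//|[]|[_]] := factor (N i0) (h i0) idfun; last exact.
have [epi0|nepi0] := pselect (comp_split_epi h i0); [left|right].
  (* If [h] is injective, [h i0] becomes a split mono; if it is surjective, [h i1] is a split epi
     wherever [i1] lies. *)
  exfalso; have [inj|surj] := irreducible_inj_surj.
    exact/ni0/split_epi_inj_mono.
  case: (ltgtP i0 i1) => [lt1|lt1|eq1]; first exact/ni1/split_mono_surj_epi/hi0.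
    exact/ni1/hepi.
  by apply: ni1; rewrite -eq1.
split=> //; exists i0; split.
  split=> // i [ni nei]; case: (ltgtP i0 i) => // lti.
    by case: ni; apply: hi0.
  by case: nei; apply: hepi.
split=> // Z u v hE; have [//|[]|[]] := factor Z u v; first by left.
by right.
Qed.

End Trichotomy.
End RepetitiveModules.

Theorem theorem3p2 (k : closedFieldType) (L : falgType k) (M N : repmod L)
    (h : repmor M N) :
  basic L ->
  @irreducible (stable_category L) M N h ->
  indecomposable M \/ indecomposable N ->
  no_projective_summand M ->
  no_projective_summand N ->
  stably_smonic h \/ stably_sepic h \/ stably_sirreducible h.
Proof.
move=> _ irr ind nM nN; have adm : stably_admissible h by [].
by have [|[|]] := irreducible_trichotomy (stable_irreducible nM nN irr);
  [left | right; left | right; right].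
Qed.
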